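(* Let $\mathcal{P}=\langle\Sigma\mid\mathcal{R}\rangle$ be a semigroup presentation and $w\in\Sigma^+$ a base word. The relation $\prec$ on the hyperplanes of the Squier complex $S(\mathcal{P},w)$ satisfies the following properties: (1) if $J_1\prec J_2$ and $J_2\prec J_3$, then $J_1\prec J_3$; (2) $J_1$ and $J_2$ are comparable with respect to $\prec$ (i.e. $J_1\prec J_2$ or $J_2\prec J_1$) if and only if they intersect (i.e. are transverse); (3) $\max\{n\geq 0 \mid \text{there exist } J_1,\dots,J_n \text{ such that } J_1\prec\cdots\prec J_n\}=\dim S(\mathcal{P},w)$ (both sides being possibly infinite).
   Context: A semigroup presentation $\mathcal{P}=\langle\Sigma\mid\mathcal{R}\rangle$ consists of an alphabet $\Sigma$ and a set $\mathcal{R}$ of relations $u=v$ with $u,v\in\Sigma^+$. Here $\Sigma^+$ is the free semigroup of non-empty words and $\Sigma^*=\Sigma^+\cup\{1\}$ also contains the empty word $1$. Convention: if $u=v\in\mathcal{R}$ then $v=u\notin\mathcal{R}$ (in particular $u=u\notin\mathcal{R}$). The Squier complex $S(\mathcal{P})$ is the cube complex whose vertices are the words over $\Sigma$; whose oriented edges are $(a,u\to v,b)$ with $a,b\in\Sigma^*$ and $u=v$ or $v=u$ in $\mathcal{R}$, going from $aub$ to $avb$ (and $(a,v\to u,b)$ is the same edge with opposite orientation); and whose $n$-cubes are similarly $(a_1,u_1\to v_1,\dots,a_n,u_n\to v_n,a_{n+1})$, spanned by the vertices $a_1w_1\cdots a_nw_na_{n+1}$ with $w_i\in\{u_i,v_i\}$.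 $S(\mathcal{P},w)$ is the connected component containing $w$. A hyperplane is an equivalence class of (unoriented) edges for the equivalence relation generated by: two edges are equivalent if they are parallel sides of some square. $[a,u\to v,b]$ denotes the hyperplane dual to (i.e. containing) the edge $(a,u\to v,b)$. Two hyperplanes $J_1,J_2$ are transverse if there are edges dual to $J_1$ and $J_2$ respectively that are non-parallel sides of some square (a hyperplane is transverse to itself exactly when it is self-intersecting). Definition of $\prec$: $J_1\prec J_2$ if there is a square $(a,u\to v,b,p\to q,c)$ of $S(\mathcal{P},w)$ with $[a,u\to v,bpc]=J_1$ and $[aub,p\to q,c]=J_2$. *)

(* Defs.v *)
From mathcomp Require Import all_boot.
From mathcomp Require Import boolp classical_sets.
From Stdlib Require Export Relation_Operators.

Set Implicit Arguments.
Unset Strict Implicit.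
Unset Printing Implicit Defensive.

Local Open Scope classical_set_scope.

(* [rels P u v] means that the relation u = v, written in this direction,
   belongs to the set of relations. *)
Record presentation (Sigma : Type) := Presentation {
  rels : seq Sigma -> seq Sigma -> Prop;
  rels_nonempty : forall u v, rels u v -> u <> [::] /\ v <> [::];
  rels_asym : forall u v, rels u v -> ~ rels v u
}.

Section SquierComplex.
Variables (Sigma : Type) (P : presentation Sigma).
Local Notation word := (seq Sigma).

(* The symbol u -> v, where u = v or v = u is a relation. *)
Record move := Move {
  lhs : word;
  rhs : word;
  moveP : rels P lhs rhs \/ rels P rhs lhs
}.

Definition inv_move (m : move) : move := Move (proj1 (or_comm _ _) (moveP m)).

(* Vertices are words. [Cube [:: (a1, m1); ...; (an, mn)] z] is the oriented
   n-cube (a1, m1, ..., an, mn, z). *)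
Record cube := Cube { cube_body : seq (word * move); cube_end : word }.

Definition cube_dim (q : cube) : nat := size (cube_body q).

Fixpoint spanned (s : seq (word * move)) (z : word) : set word :=
  match s with
  | [::] => [set z]
  | (a, m) :: s' =>
      [set x | exists y, spanned s' z y /\
                 (x = a ++ lhs m ++ y \/ x = a ++ rhs m ++ y)]
  end.

Definition cube_vertices (q : cube) : set word :=
  spanned (cube_body q) (cube_end q).

(* Oriented edges (a, u -> v, b). *)
Record edge := Edge { e_left : word; e_move : move; e_right : word }.

Definition source (e : edge) : word := e_left e ++ lhs (e_move e) ++ e_right e.
Definition target (e : edge) : word := e_left e ++ rhs (e_move e) ++ e_right e.
Definition inv_edge (e : edge) : edge :=
  Edge (e_left e) (inv_move (e_move e)) (e_right e).
Definition cube_of_edge (e : edge) : cube :=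
  Cube [:: (e_left e, e_move e)] (e_right e).
Coercion cube_of_edge : edge >-> cube.

(* Oriented squares (a, u -> v, b, p -> q, c). *)
Record square := Square {
  s_left : word; s_move1 : move; s_mid : word; s_move2 : move; s_right : word
}.

Definition cube_of_square (s : square) : cube :=
  Cube [:: (s_left s, s_move1 s); (s_mid s, s_move2 s)] (s_right s).
Coercion cube_of_square : square >-> cube.

(* The two pairs of parallel sides of a square, up to orientation. *)
Definition sides1 (s : square) : set edge :=
  let: Square a m b n c := s in
  [set Edge a m (b ++ lhs n ++ c); Edge a m (b ++ rhs n ++ c)].
Definition sides2 (s : square) : set edge :=
  let: Square a m b n c := s in
  [set Edge (a ++ lhs m ++ b) n c; Edge (a ++ rhs m ++ b) n c].

Definition same_component : word -> word -> Prop :=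
  clos_refl_sym_trans word
    (fun x y => exists e : edge, source e = x /\ target e = y).

Variable w : word.

(* The cube q belongs to S(P, w). *)
Definition in_component (q : cube) : Prop :=
  cube_vertices q `<=` same_component w.

Definition parallel (e f : edge) : Prop :=
  exists s : square, in_component s /\
    ((sides1 s e /\ sides1 s f) \/ (sides2 s e /\ sides2 s f)).

(* A set of unoriented edges is encoded by the set of all their orientations;
   this is why an edge is identified with its inverse here. *)
Definition same_hyperplane : edge -> edge -> Prop :=
  clos_refl_sym_trans edge (fun e f => f = inv_edge e \/ parallel e f).

(* [hyp (Edge a m b)] is the hyperplane [a, u -> v, b] when m is u -> v. *)
Definition hyp (e : edge) : set edge := [set f | same_hyperplane e f].

Record hyperplane := Hyperplane {
  dual_edges :> set edge;
  hyperplaneP : exists e : edge, in_component e /\ dual_edges = hyp e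
}.

Definition transverse (J1 J2 : hyperplane) : Prop :=
  exists (e1 e2 : edge) (s : square),
    [/\ dual_edges J1 e1, dual_edges J2 e2, in_component s &
        (sides1 s e1 /\ sides2 s e2) \/ (sides2 s e1 /\ sides1 s e2)].

Definition prec (J1 J2 : hyperplane) : Prop :=
  exists (a : word) (m : move) (b : word) (n : move) (c : word),
    [/\ in_component (Square a m b n c),
        hyp (Edge a m (b ++ lhs n ++ c)) = J1 &
        hyp (Edge (a ++ lhs m ++ b) n c) = J2].

(* There are J_1 prec ... prec J_n, not required to be distinct. *)
Definition has_chain (n : nat) : Prop :=
  exists J : 'I_n -> hyperplane,
    forall i j : 'I_n, j = i.+1 :> nat -> prec (J i) (J j).

(* The maximum of a nonempty set of natural numbers in nat + {oo}, where
   [None] stands for oo: the value is [None] when the set is unbounded. *)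
Definition max_nat (A : set nat) : option nat :=
  xget None [set Some n | n in [set n | A n /\ forall k, A k -> k <= n]].

Definition squier_dim : option nat :=
  max_nat [set n | exists q : cube, in_component q /\ cube_dim q = n].

End SquierComplex.

(* Main.v *)
(** The hyperplane [[a, u -> v, b]] is determined by the classes of [a] and [b]
    modulo the relations and by the relation [u = v] up to orientation, and
    every such change of [a] and [b] is realised by squares of the component.
    Consequently consecutive squares witnessing [J1 prec J2] and [J2 prec J3]
    can be glued after replacing the outer words by equivalent ones: this gives
    transitivity, and turns a chain of n hyperplanes into an n-cube.
    Conversely, the n directions of a cube, read from left to right, form a
    chain. *)

Require Import Defs.
From mathcomp Require Import all_boot.
From mathcomp Require Import boolp classical_sets.

Local Open Scope classical_set_scope.

Section Proof.
Set Implicit Arguments.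
Unset Strict Implicit.
Context {Sigma : Type} {P : presentation Sigma}.
Local Notation word := (seq Sigma).
Local Notation sc := (same_component P).

(** * Words modulo the relations, and corners of cubes *)

Lemma sc_refl (x : word) : sc x x.
Proof. exact: rst_refl. Qed.

Lemma sc_sym (x y : word) : sc x y -> sc y x.
Proof. exact: rst_sym. Qed.

Lemma sc_trans (y x z : word) : sc x y -> sc y z -> sc x z.
Proof. exact: rst_trans. Qed.

Lemma sc_ctx (a b x y : word) : sc x y -> sc (a ++ x ++ b) (a ++ y ++ b).
Proof.
elim=> {x y} [x y [e [<- <-]]|x|x y _ IH|x y z _ IH1 _ IH2].
- apply: rst_step; exists (Edge (a ++ e_left e) (e_move e) (e_right e ++ b)).
  by rewrite /source /target /= -!catA.
- exact: sc_refl.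
- exact: sc_sym.
- exact: sc_trans IH1 IH2.
Qed.

Lemma sc_cat (x x' y y' : word) : sc x x' -> sc y y' -> sc (x ++ y) (x' ++ y').
Proof.
move=> hx hy; apply: (@sc_trans (x' ++ y)); first exact: (sc_ctx [::] y).
by have := sc_ctx x' [::] hy; rewrite !cats0.
Qed.

Lemma sc_move (m : move P) : sc (lhs m) (rhs m).
Proof.
apply: rst_step; exists (Edge [::] m [::]).
by rewrite /source /target /= !cats0.
Qed.

Lemma inv_moveK (m : move P) : inv_move (inv_move m) = m.
Proof.
by case: m => u v h; rewrite /inv_move /=; congr Move; exact: Prop_irrelevance.
Qed.

(** A distinguished corner of the cube: all vertices of a cube are equivalent words, so membership
    in a component is tested at this one. *)
Definition cube_source (s : seq (word * move P)) (z : word) : word :=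
  foldr (fun p y => p.1 ++ lhs p.2 ++ y) z s.

Lemma cube_source_cat s t z :
  cube_source (s ++ t) z = cube_source s (cube_source t z).
Proof. by rewrite /cube_source foldr_cat. Qed.

Lemma cat_cube_source s x y : cube_source s x ++ y = cube_source s (x ++ y).
Proof. by elim: s => //= p s IH; rewrite -!catA IH. Qed.

Lemma spanned_source s z : spanned s z (cube_source s z).
Proof. by elim: s => //= -[a m] s IH; exists (cube_source s z); split; [|left]. Qed.

Lemma spanned_sc s z x : spanned s z x -> sc (cube_source s z) x.
Proof.
elim: s x => [x ->|[a m] s IH x /= [y [/IH hy hx]]]; first exact: sc_refl.
case: hx => ->; apply: sc_cat; try exact: sc_refl; apply: sc_cat => //.
  exact: sc_refl.
exact: sc_move.
Qed.

Variable w : word.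

Lemma in_componentP (q : cube P) :
  in_component w q <-> sc w (cube_source (cube_body q) (cube_end q)).
Proof.
split=> [|hw x /spanned_sc]; first by apply; exact: spanned_source.
exact: sc_trans hw.
Qed.

(** * Invariants of hyperplanes *)

Local Notation sh := (same_hyperplane (P := P) w).

(** Both generators respect these data: reversing an edge changes only its move, while parallel
    sides of a square share the move and differ by one rewriting in an outer word. *)
Lemma same_hyperplane_inv (e f : edge P) : sh e f ->
  [/\ sc (e_left e) (e_left f), sc (e_right e) (e_right f) &
      e_move f = e_move e \/ e_move f = inv_move (e_move e)].
Proof.
elim=> {e f} [e f [->|[[a m b n c] [_ H]]]|e|e f _ [h1 h2 h3]|
              e f g _ [h1 h2 h3] _ [k1 k2 k3]].
- by split; [exact: sc_refl|exact: sc_refl|right].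
- have hm := sc_move m; have hn := sc_move n.
  have hl : sc (a ++ lhs m ++ b) (a ++ rhs m ++ b) by exact: sc_ctx.
  have hr : sc (b ++ lhs n ++ c) (b ++ rhs n ++ c) by exact: sc_ctx.
  case: H => [] [[->|->] [->|->]] /=; split;
     by [left|exact: sc_refl|exact: sc_sym|].
- by split; [exact: sc_refl|exact: sc_refl|left].
- split; [exact: sc_sym|exact: sc_sym|].
  by case: h3 => ->; rewrite ?inv_moveK; [left|right].
- split; [exact: sc_trans h1 k1|exact: sc_trans h2 k2|].
  by case: k3 h3 => -> [] ->; rewrite ?inv_moveK; by [left|right].
Qed.

(** Each rewriting step in [b] is disjoint from [m] and spans with it a square whose sides along [m]
    are the two edges. *)
Lemma same_hyperplane_right (a : word) (m : move P) (b b' : word) :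
  sc w (a ++ lhs m ++ b) -> sc b b' -> sh (Edge a m b) (Edge a m b').
Proof.
(* The component hypothesis stays in the goal because symmetry and transitivity apply it to other
   words. *)
move=> + h; elim: h => {b b'} [b b' [e [<- <-]] hw|b _|b b' hb IH hw|
                               b c d hb IH1 _ IH2 hw].
- apply: rst_step; right; exists (Square a m (e_left e) (e_move e) (e_right e)).
  by split; [exact/in_componentP|left; split; [left|right]].
- exact: rst_refl.
- apply: rst_sym; apply: IH; apply: sc_trans hw _.
  by do 2![apply: sc_cat; first exact: sc_refl]; exact: sc_sym.
- apply: rst_trans (IH1 hw) (IH2 _); apply: sc_trans hw _.
  by do 2![apply: sc_cat; first exact: sc_refl].
Qed.

Lemma same_hyperplane_left (a a' : word) (m : move P) (b : word) :
  sc w (a ++ lhs m ++ b) -> sc a a' -> sh (Edge a m b) (Edge a' m b).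
Proof.
move=> + h; elim: h => {a a'} [a a' [e [<- <-]] hw|a _|a a' ha IH hw|
                               a c d ha IH1 _ IH2 hw].
- apply: rst_step; right; exists (Square (e_left e) (e_move e) (e_right e) m b).
  split; last by right; split; [left|right].
  by apply/in_componentP; move: hw; rewrite /source /= -!catA.
- exact: rst_refl.
- apply: rst_sym; apply: IH; apply: sc_trans hw _.
  by apply: sc_cat; [exact: sc_sym|exact: sc_refl].
- apply: rst_trans (IH1 hw) (IH2 _); apply: sc_trans hw _.
  by apply: sc_cat => //; exact: sc_refl.
Qed.

Lemma hyp_eqP (e f : edge P) : hyp w e = hyp w f <-> sh e f.
Proof.
split=> [E|h]; first by change (hyp w e f); rewrite E; exact: rst_refl.
apply/predeqP => g; split; first exact/rst_trans/rst_sym.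
exact: rst_trans.
Qed.

Lemma hyp_congr (a a' : word) (m : move P) (b b' : word) :
  sc w (a ++ lhs m ++ b) -> sc a a' -> sc b b' ->
  hyp w (Edge a m b) = hyp w (Edge a' m b').
Proof.
move=> hw ha hb.
apply/hyp_eqP.
apply: rst_trans (same_hyperplane_left hw ha) (same_hyperplane_right _ hb).
by apply: sc_trans hw _; apply: sc_cat => //; exact: sc_refl.
Qed.

(** The moves may be opposite, but a move has equivalent sides, so the orientation can be
    forgotten. *)
Lemma hyp_eq_inv (e f : edge P) : hyp w e = hyp w f ->
  [/\ sc (e_left e) (e_left f), sc (e_right e) (e_right f) &
      sc (lhs (e_move e)) (lhs (e_move f))].
Proof.
move=> /hyp_eqP /same_hyperplane_inv [hl hr hm]; split=> //.
by case: hm => ->; [exact: sc_refl|exact: sc_move].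
Qed.

Lemma hyperplane_hyp (J : hyperplane P w) (e : edge P) :
  dual_edges J e -> hyp w e = J.
Proof.
by have [f [_ ->]] := hyperplaneP J => h; apply/hyp_eqP; exact: rst_sym.
Qed.

(** * Transitivity and transversality *)

Lemma prec_trans (J1 J2 J3 : hyperplane P w) :
  prec J1 J2 -> prec J2 J3 -> prec J1 J3.
Proof.
move=> [a [m [b [n [c [/in_componentP /= hw1 h1 h2]]]]]].
move=> [a' [m' [b' [n' [c' [/in_componentP /= hw2 h3 h4]]]]]].
have /hyp_eq_inv [/= hl hr hm] := etrans h2 (esym h3).
(* Both squares see [J2], so [c] is equivalent to [b' ++ lhs n' ++ c']; substituting it makes room
   for [m], [n] and [n'] in one word, and [lhs n] is then absorbed into the middle word. *)
have hw : sc w (a ++ lhs m ++ (b ++ lhs n ++ b') ++ lhs n' ++ c').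
  apply: sc_trans hw1 _; rewrite -!catA.
  by do 4![apply: sc_cat; first exact: sc_refl].
exists a, m, (b ++ lhs n ++ b'), n', c'; split; first exact/in_componentP.
- rewrite -h1; apply: hyp_congr => //; first exact: sc_refl.
  rewrite -!catA; do 2![apply: sc_cat; first exact: sc_refl].
  exact: sc_sym.
- rewrite -h4; apply: hyp_congr; last exact: sc_refl.
  + by rewrite -!catA in hw *.
  + have -> : a ++ lhs m ++ b ++ lhs n ++ b' = (a ++ lhs m ++ b) ++ lhs n ++ b'.
      by rewrite -!catA.
    by apply: sc_cat => //; apply: sc_cat => //; exact: sc_refl.
Qed.

(** [prec] names one specific side in each direction; the parallel side is dual to the same
    hyperplane. *)
Lemma prec_of_sides (J1 J2 : hyperplane P w) (s : square P) (e1 e2 : edge P) :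
  in_component w s -> sides1 s e1 -> sides2 s e2 ->
  dual_edges J1 e1 -> dual_edges J2 e2 ->
  prec J1 J2.
Proof.
case: s => a m b n c hs s1 s2 /hyperplane_hyp E1 /hyperplane_hyp E2.
rewrite /prec -E1 -E2; exists a, m, b, n, c; split=> //; apply/hyp_eqP.
- case: s1 => ->; first exact: rst_refl.
  by apply: rst_step; right; exists (Square a m b n c); split=> //; left; split;
    [left|right].
- case: s2 => ->; first exact: rst_refl.
  by apply: rst_step; right; exists (Square a m b n c); split=> //; right; split;
    [left|right].
Qed.

Lemma prec_sides (J1 J2 : hyperplane P w) : prec J1 J2 ->
  exists (e1 e2 : edge P) (s : square P),
    [/\ dual_edges J1 e1, dual_edges J2 e2, in_component w s &
        sides1 s e1 /\ sides2 s e2].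
Proof.
move=> [a [m [b [n [c [hs <- <-]]]]]].
exists (Edge a m (b ++ lhs n ++ c)), (Edge (a ++ lhs m ++ b) n c).
exists (Square a m b n c); split=> //; try exact: rst_refl.
by split; left.
Qed.

Lemma comparable_transverse (J1 J2 : hyperplane P w) :
  (prec J1 J2 \/ prec J2 J1) <-> transverse J1 J2.
Proof.
split.
- case=> /prec_sides [e1 [e2 [s [h1 h2 hs [s1 s2]]]]].
    by exists e1, e2, s; split=> //; left.
  by exists e2, e1, s; split=> //; right.
- move=> [e1 [e2 [s [h1 h2 hs]]]] [] [s1 s2].
    by left; exact: prec_of_sides hs s1 s2 h1 h2.
  by right; exact: prec_of_sides hs s2 s1 h2 h1.
Qed.

(** * Chains and cubes *)

(** The last conjunct strengthens the induction: it ties the first direction of the cube to the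
    first hyperplane, so that a further direction can be prepended. *)
Lemma chain_cube (n : nat) (J : 'I_n.+1 -> hyperplane P w) :
  (forall i j : 'I_n.+1, j = i.+1 :> nat -> prec (J i) (J j)) ->
  exists (a : word) (m : move P) (s : seq (word * move P)) (z : word),
    [/\ size s = n, sc w (cube_source ((a, m) :: s) z) &
        hyp w (Edge a m (cube_source s z)) = J ord0].
Proof.
elim: n J => [|n IH] J hJ.
  have [[a m b] [/in_componentP hw ->]] := hyperplaneP (J ord0).
  by exists a, m, [::], b.
have [i j hij|a [m [s [z [hs hw hJ1]]]]] := IH (J \o lift ord0).
  by apply: hJ; rewrite /= hij.
have /= [a0 [m0 [b [k [c [/in_componentP /= hw0 h0 h1]]]]]] :=
  hJ ord0 (lift ord0 ord0) erefl.
have /hyp_eq_inv [/= _ hc _] := etrans h1 (esym hJ1).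
have hbc : sc (b ++ lhs k ++ c) (b ++ lhs k ++ cube_source s z).
  by do 2![apply: sc_cat; first exact: sc_refl].
(* The head [(a, m)] of the tail cube gives way to [(b, k)] from the new square; [k] is [m] up to
   orientation. *)
exists a0, m0, ((b, k) :: s), z; split=> /=; first by rewrite hs.
  apply: sc_trans hw0 _.
  by do 2![apply: sc_cat; first exact: sc_refl].
by rewrite -h0; apply/esym/hyp_congr => //; exact: sc_refl.
Qed.

Lemma cube_chain (s : seq (word * move P)) (z : word) :
  sc w (cube_source s z) -> has_chain P w (size s).
Proof.
move=> hw; pose p (i : 'I_(size s)) := tnth (in_tuple s) i.
have hp (i : 'I_(size s)) x : nth x s i = p i by rewrite /p (tnth_nth x).
have hd (i : 'I_(size s)) : drop i s = p i :: drop i.+1 s.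
  by rewrite (drop_nth (p i)) // hp.
(* The edge in direction [i] at the distinguished corner; two consecutive directions span the square
   needed for [prec]. *)
pose e (i : 'I_(size s)) := Edge (cube_source (take i s) (p i).1) (p i).2
                                  (cube_source (drop i.+1 s) z).
have he i : in_component w (e i).
  apply/in_componentP => /=; rewrite cat_cube_source.
  rewrite -[s in sc _ (cube_source s _)](cat_take_drop i) in hw.
  by rewrite cube_source_cat hd in hw.
exists (fun i => Hyperplane (ex_intro _ (e i) (conj (he i) erefl))) => i j hij.
exists (e_left (e i)), (p i).2, (p j).1, (p j).2, (cube_source (drop j.+1 s) z).
have E1 : e_right (e i) = (p j).1 ++ lhs (p j).2 ++ cube_source (drop j.+1 s) z.
  by rewrite /= -hij hd.
have E2 : e_left (e i) ++ lhs (p i).2 ++ (p j).1 = e_left (e j).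
  rewrite /= cat_cube_source hij (take_nth (p i)) // hp -cats1.
  by rewrite cube_source_cat.
split=> /=.
- by apply/in_componentP => /=; rewrite -E1; have /in_componentP := he i.
- by rewrite -E1.
- by rewrite E2.
Qed.

Lemma has_chainE :
  has_chain P w = [set n | exists q : cube P, in_component w q /\ cube_dim q = n].
Proof.
apply/predeqP => n; split.
- case: n => [_|n [J /chain_cube [a [m [s [z [hs hw _]]]]]]].
    (* The empty chain corresponds to the vertex [w]. *)
    by exists (Cube [::] w); split=> //; apply/in_componentP; exact: sc_refl.
  exists (Cube ((a, m) :: s) z); split; first exact/in_componentP.
  by rewrite /cube_dim /= hs.
- by move=> [[s z] [/in_componentP hw <-]]; exact: cube_chain hw.
Qed.

End Proof.

Theorem proposition1p3 (Sigma : Type) (P : presentation Sigma)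
    (w : seq Sigma) (hw : w <> [::]) :
  [/\ forall J1 J2 J3 : hyperplane P w,
        prec J1 J2 -> prec J2 J3 -> prec J1 J3,
      forall J1 J2 : hyperplane P w,
        (prec J1 J2 \/ prec J2 J1) <-> transverse J1 J2 &
      max_nat [set n | has_chain P w n] = squier_dim P w].
Proof.
split; [exact: prec_trans|exact: comparable_transverse|].
(* The sets themselves coincide, which also settles the infinite case. *)
by congr max_nat; exact: has_chainE.
Qed.
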